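(* Let $\mathbf{L}$ be a normal modal logic. Then its global consequence relation $\vdash_{\mathbf{L}}$ has a weak excluded middle law (WEML) if and only if there exists $n\in\omega$ such that $$\vdash_{\mathbf{L}}\boxplus^n v\to\Diamond_+^n\boxplus^{n+1}v\quad\text{and}\quad\vdash_{\mathbf{L}}\boxplus^m\neg\boxplus^n v\,\vee\,\boxplus^m\neg\boxplus^n\neg\boxplus^n v\ \text{ for all } m\in\omega.$$
   Context: $\omega=\{0,1,2,\dots\}$, $\mathbb{N}^+=\{1,2,\dots\}$; $v_1,v_2,\dots$ is a fixed sequence of distinct variables from the infinite set of variables, and $v=v_1$. A modal formula is a formula in the signature of classical propositional logic expanded by a unary connective $\Box$; $\Diamond\alpha$ abbreviates $\neg\Box\neg\alpha$. Put $\Box^0\alpha=\alpha$, $\Box^{n+1}\alpha=\Box\Box^n\alpha$, and similarly for $\Diamond^n$. For $n\in\omega$, $$\boxplus^n\varphi=\varphi\wedge\Box\varphi\wedge\dots\wedge\Box^n\varphi,\qquad \Diamond_+^n\varphi=\varphi\vee\Diamond\varphi\vee\dots\vee\Diamond^n\varphi.$$ A normal modal logic $\mathbf{L}$ is a set of modal formulas that contains all classical tautologies and $\Box(v_1\to v_2)\to(\Box v_1\to\Box v_2)$, and is closed under substitution, modus ponens and necessitation (from $\alpha$ infer $\Box\alpha$). Its global consequence relation $\vdash_{\mathbf{L}}$ is defined by: $\Gamma\vdash_{\mathbf{L}}\alpha$ iff $\alpha$ is derivable from $\Gamma\cup\mathbf{L}$ using the rules of modus ponens and necessitation. The theorems of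 $\vdash_{\mathbf{L}}$ are exactly the elements of $\mathbf{L}$. Definition of WEML. Let $\mathit{Fm}$ be the set of all modal formulas and $\mathit{Fm}(n)$ the set of those whose variables are among $v_1,\dots,v_n$. For $\Psi\subseteq\mathit{Fm}(n)$, $\Psi(\alpha_1,\dots,\alpha_n)$ is the result of substituting $\alpha_i$ for $v_i$ in all members of $\Psi$; $\Gamma\vdash\Pi$ means $\Gamma\vdash\alpha$ for all $\alpha\in\Pi$. A set $\Xi$ of formulas is inconsistent in $\vdash$ if $\Xi\vdash\alpha$ for all $\alpha\in\mathit{Fm}$. An elementary IL-sequence for $\vdash$ is a family $\{\Psi_n:n\in\mathbb{N}^+\}$ of finite sets $\Psi_n\subseteq\mathit{Fm}(n)$ such that for all $n\in\mathbb{N}^+$ and all $\Gamma\cup\{\alpha_1,\dots,\alpha_n\}\subseteq\mathit{Fm}$: $\Gamma\cup\{\alpha_1,\dots,\alpha_n\}$ is inconsistent in $\vdash$ iff $\Gamma\vdash\Psi_n(\alpha_1,\dots,\alpha_n)$. Given such a sequence, let $\#n=|\Psi_n|$, $\Psi_n=\{\psi_n^1,\dots,\psi_n^{\#n}\}$ and $\Psi_{\#n}\Psi_n=\Psi_{\#n}(\psi_n^1,\dots,\psi_n^{\#n})\subseteq\mathit{Fm}(n)$ (the order of enumeration is immaterial up to interderivability). $\vdash$ has a WEML if it has an elementary IL-sequence $\{\Psi_n\}$ such that for all $n\in\mathbb{N}^+$ and all $\Gamma\cup\{\alpha_1,\dots,\alpha_n,\varphi\}\subseteq\mathit{Fm}$: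 if $\Gamma\cup\Psi_n(\alpha_1,\dots,\alpha_n)\vdash\varphi$ and $\Gamma\cup\Psi_{\#n}\Psi_n(\alpha_1,\dots,\alpha_n)\vdash\varphi$, then $\Gamma\vdash\varphi$. (If $\Psi_n=\emptyset$, this condition for $n$ is trivially true.) *)

(* Defs.v *)
From HB Require Import structures.
From mathcomp Require Import all_boot.
From mathcomp Require Import classical_sets.

Set Implicit Arguments.
Unset Strict Implicit.
Unset Printing Implicit Defensive.

Local Open Scope classical_set_scope.

(* The variables are an arbitrary eqType V together with an injective
   sequence v : nat -> V.  Indexing starts at 0: v i stands for v_{i+1}, so
   v_1, ..., v_n are the elements of mkseq v n. *)

Inductive form (V : Type) : Type :=
| Var of V
| Bot
| Top
| Neg of form V
| And of form V & form V
| Or of form V & form V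
| Imp of form V & form V
| Box of form V.

Arguments Bot {V}.
Arguments Top {V}.

Section FormEqType.
Variable V : eqType.

Fixpoint form_encode (p : form V) : GenTree.tree V :=
  match p with
  | Var x => GenTree.Leaf x
  | Bot => GenTree.Node 0 [::]
  | Top => GenTree.Node 1 [::]
  | Neg a => GenTree.Node 2 [:: form_encode a]
  | And a b => GenTree.Node 3 [:: form_encode a; form_encode b]
  | Or a b => GenTree.Node 4 [:: form_encode a; form_encode b]
  | Imp a b => GenTree.Node 5 [:: form_encode a; form_encode b]
  | Box a => GenTree.Node 6 [:: form_encode a]
  end.

Fixpoint form_decode (t : GenTree.tree V) : option (form V) :=
  match t with
  | GenTree.Leaf x => Some (Var x)
  | GenTree.Node 0 [::] => Some Bot
  | GenTree.Node 1 [::] => Some Top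
  | GenTree.Node 2 [:: a] => omap (@Neg V) (form_decode a)
  | GenTree.Node 3 [:: a; b] =>
      obind (fun p => omap (And p) (form_decode b)) (form_decode a)
  | GenTree.Node 4 [:: a; b] =>
      obind (fun p => omap (Or p) (form_decode b)) (form_decode a)
  | GenTree.Node 5 [:: a; b] =>
      obind (fun p => omap (Imp p) (form_decode b)) (form_decode a)
  | GenTree.Node 6 [:: a] => omap (@Box V) (form_decode a)
  | _ => None
  end.

Lemma form_encodeK : pcancel form_encode form_decode.
Proof. by elim=> //= [a ->|a -> b ->|a -> b ->|a -> b ->|a ->]. Qed.

HB.instance Definition _ := Equality.copy (form V) (pcan_type form_encodeK).

End FormEqType.

Definition Dia (V : Type) (a : form V) : form V := Neg (Box (Neg a)).

Fixpoint boxplus (V : Type) (n : nat) (a : form V) : form V :=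
  if n is k.+1 then And (boxplus k a) (iter n (@Box V) a) else a.

Fixpoint diaplus (V : Type) (n : nat) (a : form V) : form V :=
  if n is k.+1 then Or (diaplus k a) (iter n (@Dia V) a) else a.

Fixpoint subst (V : Type) (s : V -> form V) (p : form V) : form V :=
  match p with
  | Var x => s x
  | Bot => Bot
  | Top => Top
  | Neg a => Neg (subst s a)
  | And a b => And (subst s a) (subst s b)
  | Or a b => Or (subst s a) (subst s b)
  | Imp a b => Imp (subst s a) (subst s b)
  | Box a => Box (subst s a)
  end.

Fixpoint vars (V : Type) (p : form V) : seq V :=
  match p with
  | Var x => [:: x]
  | Bot | Top => [::]
  | Neg a | Box a => vars a
  | And a b | Or a b | Imp a b => vars a ++ vars b
  end.

(* Boxed subformulas are treated as propositional atoms, valued by f. *)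
Fixpoint prop_eval (V : Type) (e : V -> bool) (f : form V -> bool)
    (p : form V) : bool :=
  match p with
  | Var x => e x
  | Bot => false
  | Top => true
  | Neg a => ~~ prop_eval e f a
  | And a b => prop_eval e f a && prop_eval e f b
  | Or a b => prop_eval e f a || prop_eval e f b
  | Imp a b => prop_eval e f a ==> prop_eval e f b
  | Box a => f a
  end.

Definition tautology (V : Type) (p : form V) : Prop :=
  forall (e : V -> bool) (f : form V -> bool), prop_eval e f p.

Record normal_modal_logic (V : Type) (v : nat -> V) (L : set (form V)) : Prop :=
  NormalModalLogic {
    nml_taut : forall p, tautology p -> L p;
    nml_K : L (Imp (Box (Imp (Var (v 0)) (Var (v 1))))
                   (Imp (Box (Var (v 0))) (Box (Var (v 1)))));
    nml_subst : forall s p, L p -> L (subst s p);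
    nml_mp : forall p q, L (Imp p q) -> L p -> L q;
    nml_nec : forall p, L p -> L (Box p) }.

Inductive global_consequence (V : Type) (L Gamma : set (form V)) :
    form V -> Prop :=
| gc_hyp p : Gamma p -> global_consequence L Gamma p
| gc_thm p : L p -> global_consequence L Gamma p
| gc_mp p q : global_consequence L Gamma (Imp p q) ->
    global_consequence L Gamma p -> global_consequence L Gamma q
| gc_nec p : global_consequence L Gamma p -> global_consequence L Gamma (Box p).

Section WEML.
Variables (V : eqType) (v : nat -> V).
Variable entails : set (form V) -> form V -> Prop.

Definition Fm (n : nat) (p : form V) : Prop := {subset vars p <= mkseq v n}.

(* The substitution v_i |-> a_i for a = [:: a_1; ...; a_n]; all variables
   other than v_1, ..., v_n are fixed. *)
Definition seq_subst (a : seq (form V)) (x : V) : form V :=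
  nth (Var x) a (index x (mkseq v (size a))).

Definition inst (Psi a : seq (form V)) : seq (form V) :=
  map (subst (seq_subst a)) Psi.

Definition inconsistent (Xi : set (form V)) : Prop :=
  forall p, entails Xi p.

(* A finite set is given as a duplicate-free sequence, i.e. together with an
   enumeration, so that its cardinality is its size.  The family is indexed
   by the positive integers: nothing is required of Psi 0. *)
Definition elementary_IL_sequence (Psi : nat -> seq (form V)) : Prop :=
  forall n, 0 < n ->
    [/\ uniq (Psi n),
        forall p, p \in Psi n -> Fm n p
      & forall (Gamma : set (form V)) (a : n.-tuple (form V)),
          inconsistent (Gamma `|` [set` a]) <->
          (forall p, p \in inst (Psi n) a -> entails Gamma p)].

(* If Psi n is empty then the value Psi 0 occurs below, but in that case the
   first premise is already the conclusion. *)
Definition has_WEML : Prop :=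
  exists2 Psi : nat -> seq (form V), elementary_IL_sequence Psi &
    forall n, 0 < n ->
    forall (Gamma : set (form V)) (a : n.-tuple (form V)) (p : form V),
      entails (Gamma `|` [set` inst (Psi n) a]) p ->
      entails
        (Gamma `|` [set` inst (inst (Psi (size (Psi n))) (Psi n)) a]) p ->
      entails Gamma p.

End WEML.

(* Main.v *)
Require Import Defs.
From HB Require Import structures.
From mathcomp Require Import all_boot.
From mathcomp Require Import classical_sets.

Set Implicit Arguments.
Unset Strict Implicit.
Unset Printing Implicit Defensive.

(** Two facts about the global consequence relation carry the proof. By the
    local deduction theorem ([deduction]), anything derived from hypotheses
    [Gamma] and [a] follows from [Gamma] by an implication with antecedent
    [boxplus k a], for some [k] that depends on the derivation. Hence adding
    [a] to [Gamma] is inconsistent iff [Gamma] proves [Neg (boxplus k a)] for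
    some [k] ([inconsistent_conjP]). An IL-sequence has to express this with
    one finite set of formulas, so it must bound [k] uniformly.

    The first condition of the theorem provides this uniform bound. By the
    duality [diaplus_dual] it makes [Neg (boxplus n v)] follow from
    [boxplus n (Neg (boxplus n.+1 v))], hence, by necessitation, from
    [Neg (boxplus n.+1 v)]. Substituting [boxplus j v] for [v] gives the same
    step from [(n + j).+1] to [n + j] ([return_shift]), so every
    [Neg (boxplus k a)] entails [Neg (boxplus n a)] ([neg_boxplus_collapse]).
    The inconsistency of [a] is then expressed by [Neg (boxplus n a)].

    Given such an [n], the second condition is the excluded middle for this
    negation. In the law, the two premises become implications with
    antecedents [boxplus m (Neg (boxplus n a))] and
    [boxplus m (Neg (boxplus n (Neg (boxplus n a))))] for a common [m], and the
    second condition is the disjunction of these two antecedents.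

    Conversely, an IL-sequence is used only at arity one, on the variable [v].
    [Psi 1] is inconsistent with [v], hence entails some [Neg (boxplus n v)];
    and each [Neg (boxplus k v)], being inconsistent with [v], entails [Psi 1].
    So [Neg (boxplus n.+1 v)] entails [Neg (boxplus n v)]. The deduction theorem
    turns this into the first condition with some [k] in place of [n] as the
    exponent of [diaplus], and passing to [maxn n k] makes the two exponents
    agree. The iterated set [inst (Psi (size (Psi 1))) (Psi 1)] entails the
    second negation of [v], and the law applied to the required disjunction
    yields the second condition. *)

Section GlobalConsequence.
Local Open Scope classical_set_scope.
Variables (V : eqType) (v : nat -> V).
Hypothesis v_inj : injective v.
Variable L : set (form V).
Hypothesis L_normal : normal_modal_logic v L.

Local Notation "G |- p" := (global_consequence L G p) (at level 70).

Implicit Types (a p q r : form V) (G D A : set (form V)) (ps : seq (form V)).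

Local Notation Iff p q := (And (Imp p q) (Imp q p)).
Local Notation x0 := (Var (v 0)).

(** * Modal reasoning inside a theory *)

Lemma gc_taut G p : tautology p -> G |- p.
Proof. by move=> /(nml_taut L_normal); exact: gc_thm. Qed.

(* Decides tautologies by truth tables over the subformulas on which
   evaluation is stuck. *)
Ltac by_taut :=
  apply: gc_taut; let e := fresh "e" in let f := fresh "f" in
  move=> e f /=;
  repeat match goal with
  | |- context [prop_eval e f ?p] => case: (prop_eval e f p)
  | |- context [f ?p] => case: (f p)
  | |- context [e ?x] => case: (e x)
  end; done.

Lemma gc_cut G D p : (forall q, G q -> D |- q) -> G |- p -> D |- p.
Proof.
move=> GD; elim=> [q /GD //|q Lq|q r _ IHqr _ IHq|q _ IHq].
- exact: gc_thm.
- exact: gc_mp IHqr IHq.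
- exact: gc_nec.
Qed.

Lemma gc_weaken G p : set0 |- p -> G |- p.
Proof. by apply: gc_cut. Qed.

Lemma gc_empty p : set0 |- p -> L p.
Proof.
elim=> [//|//|q r _ Lqr _ Lq|q _ Lq]; first exact: (nml_mp L_normal Lqr Lq).
exact: (nml_nec L_normal Lq).
Qed.

Lemma gc_subst s p G : set0 |- p -> G |- subst s p.
Proof. by move=> /gc_empty Lp; exact/gc_thm/(nml_subst L_normal). Qed.

Lemma gc_K G p q : G |- Imp (Box (Imp p q)) (Imp (Box p) (Box q)).
Proof.
have := nml_subst L_normal (fun x => if x == v 0 then p else q) (nml_K L_normal).
by rewrite /= eqxx (inj_eq v_inj) /=; exact: gc_thm.
Qed.

Lemma box_mono G p q : G |- Imp p q -> G |- Imp (Box p) (Box q).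
Proof. by move=> /gc_nec; apply: gc_mp (gc_K _ _ _). Qed.

Lemma box_iff G p q : G |- Iff p q -> G |- Iff (Box p) (Box q).
Proof.
move=> pq.
have pq1 : G |- Imp p q by apply: (gc_mp _ pq); by_taut.
have pq2 : G |- Imp q p by apply: (gc_mp _ pq); by_taut.
apply: (gc_mp _ (box_mono pq1)); apply: (gc_mp _ (box_mono pq2)); by_taut.
Qed.

Lemma box_and G p q : G |- Iff (Box (And p q)) (And (Box p) (Box q)).
Proof.
have H1 : G |- Imp (Box (And p q)) (Box p) by apply: box_mono; by_taut.
have H2 : G |- Imp (Box (And p q)) (Box q) by apply: box_mono; by_taut.
have H3 : G |- Imp (Box p) (Box (Imp q (And p q))) by apply: box_mono; by_taut.
apply: (gc_mp _ H1); apply: (gc_mp _ H2); apply: (gc_mp _ H3).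
apply: (gc_mp _ (gc_K G q (And p q))); by_taut.
Qed.

(** * The operators boxplus and diaplus *)

(** [boxplus] adds its outermost conjunct last, which does not interact with
    necessitation; this form exposes a box around a shorter [boxplus]. *)
Lemma boxplus_recl G n p :
  G |- Iff (boxplus n.+1 p) (And p (Box (boxplus n p))).
Proof.
elim: n => [|n IHn]; first by by_taut.
apply: (gc_mp _ IHn).
apply: (gc_mp _ (box_and G (boxplus n p) (iter n.+1 (@Box V) p))); by_taut.
Qed.

Lemma boxplus_mono G n p q :
  G |- Imp p q -> G |- Imp (boxplus n p) (boxplus n q).
Proof.
move=> pq; elim: n => [//|n /box_mono IHn].
apply: (gc_mp _ (boxplus_recl G n p)); apply: (gc_mp _ (boxplus_recl G n q)).
apply: (gc_mp _ IHn); apply: (gc_mp _ pq); by_taut.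
Qed.

Lemma boxplus_le G m n p : m <= n -> G |- Imp (boxplus n p) (boxplus m p).
Proof.
elim: n => [|n IHn]; first by rewrite leqn0 => /eqP ->; by_taut.
rewrite leq_eqVlt => /orP[/eqP ->|/IHn mn]; first by by_taut.
apply: (gc_mp _ mn); by_taut.
Qed.

Lemma boxplus_intro G n p : G |- p -> G |- boxplus n p.
Proof.
move=> Gp; elim: n => [//|n /gc_nec IHn].
apply: (gc_mp _ (boxplus_recl G n p)); apply: (gc_mp _ Gp).
apply: (gc_mp _ IHn); by_taut.
Qed.

Lemma boxplusD G m n p :
  G |- Iff (boxplus m (boxplus n p)) (boxplus (m + n) p).
Proof.
elim: m => [|m /box_iff IHm]; first by by_taut.
apply: (gc_mp _ IHm); rewrite addSn.
apply: (gc_mp _ (boxplus_recl G m (boxplus n p))).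
apply: (gc_mp _ (boxplus_recl G (m + n) p)).
have le_n : n <= (m + n).+1 by rewrite leqW ?leq_addl.
apply: (gc_mp _ (boxplus_le G p le_n)).
apply: (gc_mp _ (boxplus_le G p (leq0n n))).
(* Both [boxplus] terms stay atomic: unfolding them would hide the match with
   the recursion equation. *)
move: (boxplus _.+1 _) (boxplus _.+1 _) => P Q; by_taut.
Qed.

Lemma diaplus_dual G n p : G |- Iff (diaplus n p) (Neg (boxplus n (Neg p))).
Proof.
have dia_dual k : G |- Iff (iter k (@Dia V) p) (Neg (iter k (@Box V) (Neg p))).
  elim: k => [|k IHk]; first by by_taut.
  have IHk' : G |- Iff (Neg (iter k (@Dia V) p)) (iter k (@Box V) (Neg p)).
    apply: (gc_mp _ IHk); by_taut.
  apply: (gc_mp _ (box_iff IHk')); by_taut.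
elim: n => [|n IHn]; first by by_taut.
apply: (gc_mp _ IHn); apply: (gc_mp _ (dia_dual n.+1)); by_taut.
Qed.

Lemma subst_boxplus s n p : subst s (boxplus n p) = boxplus n (subst s p).
Proof.
have subst_box k : subst s (iter k (@Box V) p) = iter k (@Box V) (subst s p).
  by elim: k => //= k ->.
by elim: n => //= n ->; rewrite subst_box.
Qed.

(** * The local deduction theorem *)

(** Necessitation is the step that raises the exponent, and modus ponens
    takes the larger of two exponents. The formula [a] stands for a
    conjunction of the set [A]. *)
Lemma deduction G A a p :
    (forall q, A q -> G |- Imp a q) ->
  G `|` A |- p -> exists k, G |- Imp (boxplus k a) p.
Proof.
move=> aA; elim=> [q [Gq|/aA aq]|q Lq|q r _ [k IHk] _ [l IHl]|q _ [k IHk]].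
- exists 0; apply: (gc_mp _ (gc_hyp L Gq)); by_taut.
- by exists 0.
- exists 0; apply: (gc_mp _ (gc_thm G Lq)); by_taut.
- exists (maxn k l); apply: (gc_mp _ IHk); apply: (gc_mp _ IHl).
  apply: (gc_mp _ (boxplus_le G a (leq_maxl k l))).
  apply: (gc_mp _ (boxplus_le G a (leq_maxr k l))); by_taut.
- exists k.+1; apply: (gc_mp _ (box_mono IHk)).
  apply: (gc_mp _ (boxplus_recl G k a)).
  by move: (boxplus _.+1 _) => P; by_taut.
Qed.

Lemma deduction1 G a p :
  G `|` [set a] |- p -> exists k, G |- Imp (boxplus k a) p.
Proof. by apply: deduction => q ->; by_taut. Qed.

Definition conj_seq ps : form V := foldr (@And V) Top ps.

Lemma conj_seq_elim G ps q : q \in ps -> G |- Imp (conj_seq ps) q.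
Proof.
elim: ps => //= p ps IHps; rewrite inE => /orP[/eqP ->|/IHps IH].
  by by_taut.
apply: (gc_mp _ IH); by_taut.
Qed.

Lemma conj_seq_intro G ps : (forall q, q \in ps -> G |- q) -> G |- conj_seq ps.
Proof.
elim: ps => [|p ps IHps] Gps /=; first by by_taut.
apply: (gc_mp _ (Gps p (mem_head _ _))).
have /IHps Gc : forall q, q \in ps -> G |- q.
  by move=> q qps; apply: Gps; rewrite inE qps orbT.
apply: (gc_mp _ Gc); by_taut.
Qed.

Lemma inconsistent_conjP G A a :
    (forall q, A q -> G |- Imp a q) -> G `|` A |- a ->
  inconsistent (global_consequence L) (G `|` A) <->
  exists k, G |- Neg (boxplus k a).
Proof.
move=> aA Aa; split=> [/(_ Bot) /(deduction aA) [k ak]|[k nak] p].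
  by exists k; apply: (gc_mp _ ak); by_taut.
apply: (gc_mp _ (boxplus_intro k Aa)).
have nak' : G `|` A |- Neg (boxplus k a).
  by apply: gc_cut nak => q Gq; apply: gc_hyp; left.
apply: (gc_mp _ nak'); by_taut.
Qed.

Lemma inconsistent_seqP G ps :
  inconsistent (global_consequence L) (G `|` [set` ps]) <->
  exists k, G |- Neg (boxplus k (conj_seq ps)).
Proof.
apply: inconsistent_conjP => [q|]; first exact: conj_seq_elim.
by apply: conj_seq_intro => q psq; apply: gc_hyp; right.
Qed.

(** * Collapsing the negations of boxplus *)

(** The first condition of the theorem, dualised, with independent parameters
    and for all formulas instead of a variable. *)
Definition returns n k :=
  forall p, set0 |- Imp (boxplus n p) (Neg (boxplus k (Neg (boxplus n.+1 p)))).

Lemma returnsP n k :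
  set0 |- Imp (boxplus n x0) (diaplus k (boxplus n.+1 x0)) <-> returns n k.
Proof.
have dual := diaplus_dual set0 k (boxplus n.+1 x0).
split=> [H p|H].
  have H' : set0 |- Imp (boxplus n x0) (Neg (boxplus k (Neg (boxplus n.+1 x0)))).
    apply: (gc_mp _ H); apply: (gc_mp _ dual).
    by move: (boxplus n.+1 _) => P; by_taut.
  pose s (x : V) := p.
  have : set0 |- Imp (subst s (boxplus n x0))
      (Neg (subst s (boxplus k (Neg (boxplus n.+1 x0))))) := gc_subst s set0 H'.
  rewrite !subst_boxplus.
  by rewrite -[subst s (Neg _)]/(Neg (subst s (boxplus n.+1 x0))) subst_boxplus.
apply: (gc_mp _ (H x0)); apply: (gc_mp _ dual).
by move: (boxplus n.+1 _) => P; by_taut.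
Qed.

(** The instance at [boxplus j p] raises both exponents by [j], because nested
    [boxplus] add up. *)
Lemma return_shift n k N : n <= N -> returns n k -> returns N k.
Proof.
move=> /subnK <- H p; set j := N - n; rewrite addnC.
apply: (gc_mp _ (H (boxplus j p))); apply: (gc_mp _ (boxplusD set0 n j p)).
have := boxplusD set0 n.+1 j p; rewrite addSn.
move: (boxplus n.+1 _) (boxplus (n + j).+1 _) => P Q PQ.
have /(@boxplus_mono _ k) QP : set0 |- Imp (Neg Q) (Neg P).
  by apply: (gc_mp _ PQ); by_taut.
apply: (gc_mp _ QP); by_taut.
Qed.

(** Below [n] this is monotonicity of [boxplus]. Above [n], each descending
    step necessitates [k] times and contradicts the shifted return. *)
Lemma neg_boxplus_collapse n k G p m :
  returns n k -> G |- Neg (boxplus m p) -> G |- Neg (boxplus n p).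
Proof.
move=> H; have step N : n <= N ->
    G |- Neg (boxplus N.+1 p) -> G |- Neg (boxplus N p).
  move=> nN /(@boxplus_intro _ k) GN.
  apply: (gc_mp _ GN); apply: (gc_mp _ (gc_weaken G (return_shift nN H p))).
  by move: (boxplus N.+1 _) => P; by_taut.
have [mn Gm|nm] := leqP m n.
  by apply: (gc_mp _ Gm); apply: (gc_mp _ (boxplus_le G p mn)); by_taut.
rewrite -(subnK (ltnW nm)); elim: (m - n) => // j IHj Gj.
by apply/IHj/step; rewrite ?leq_addl.
Qed.

(** * From the modal conditions to the law *)

Lemma seq_subst_nth ps i : i < size ps -> seq_subst v ps (v i) = nth Bot ps i.
Proof.
move=> ia; rewrite /seq_subst -{2}(nth_mkseq (v 0) v ia).
by rewrite index_uniq ?size_mkseq ?mkseq_uniq //; exact: set_nth_default.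
Qed.

Lemma inst_neg_boxplus_conj n ps :
  inst v [:: Neg (boxplus n (conj_seq (map (@Var V) (mkseq v (size ps)))))] ps
  = [:: Neg (boxplus n (conj_seq ps))].
Proof.
have subst_conj s qs : subst s (conj_seq qs) = conj_seq (map (subst s) qs).
  by elim: qs => //= q qs ->.
rewrite /inst /= subst_boxplus subst_conj; congr [:: Neg (boxplus _ (conj_seq _))].
apply: (@eq_from_nth _ Bot); rewrite !size_map ?size_iota // => i ia.
rewrite (nth_map Bot) ?size_map ?size_iota //.
rewrite (nth_map (v 0)) ?size_map ?size_iota //= nth_mkseq //.
exact: seq_subst_nth.
Qed.

Lemma vars_boxplus n p : {subset vars (boxplus n p) <= vars p}.
Proof.
have vars_box k : vars (iter k (@Box V) p) = vars p by elim: k.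
elim: n => //= n IHn x; rewrite mem_cat => /orP[/IHn //|].
by rewrite vars_box.
Qed.

Lemma vars_conj_vars (xs : seq V) : vars (conj_seq (map (@Var V) xs)) = xs.
Proof. by elim: xs => //= x xs ->. Qed.

(** The witness for [m] formulas is the single formula
    [Neg (boxplus n c)], with [c] the conjunction of the first [m] variables.
    Being a singleton, its iterate is built from the witness for one formula,
    so that the law compares one negation with the double one. *)
Lemma WEML_of_conditions n k : returns n k ->
    (forall m, set0 |- Or (boxplus m (Neg (boxplus n x0)))
                         (boxplus m (Neg (boxplus n (Neg (boxplus n x0)))))) ->
  has_WEML v (global_consequence L).
Proof.
move=> Hn Hor.
pose Psi m := [:: Neg (boxplus n (conj_seq (map (@Var V) (mkseq v m))))].
have instPsi m (a : m.-tuple (form V)) :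
    inst v (Psi m) a = [:: Neg (boxplus n (conj_seq a))].
  by have := inst_neg_boxplus_conj n a; rewrite size_tuple.
exists Psi => m m0; first split=> // [p|G a].
- by rewrite inE => /eqP -> x /vars_boxplus; rewrite vars_conj_vars.
- rewrite instPsi; split=> [/inconsistent_seqP [j Gj] p|Gp].
    by rewrite inE => /eqP ->; apply: neg_boxplus_collapse Hn Gj.
  by apply/inconsistent_seqP; exists n; apply: Gp; rewrite inE.
move=> G a p.
have -> : inst v (inst v (Psi (size (Psi m))) (Psi m)) a
    = [:: Neg (boxplus n (And (Neg (boxplus n (conj_seq a))) Top))].
  rewrite (instPsi _ [tuple of Psi m]) /inst /= subst_boxplus /=.
  by have := instPsi m a; rewrite /inst /= => -[->].
rewrite instPsi; set b := conj_seq a.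
have toset1 q D : D `|` [set` [:: q]] = D `|` [set q].
  by congr setU; apply/seteqP; split=> r /=; rewrite inE => /eqP.
rewrite !toset1 => /deduction1 [i Hi] /deduction1 [j Hj].
have := gc_subst (fun=> b) G (Hor (maxn i j)).
rewrite /= !subst_boxplus /= !subst_boxplus /= subst_boxplus /= => Hb.
(* [conj_seq] closes the one-element conjunction with [Top]. *)
have Hdrop : G |- Imp (Neg (boxplus n (Neg (boxplus n b))))
                      (Neg (boxplus n (And (Neg (boxplus n b)) Top))).
  have dropT : G |- Imp (And (Neg (boxplus n b)) Top) (Neg (boxplus n b)).
    by by_taut.
  by apply: (gc_mp _ (boxplus_mono n dropT)); by_taut.
apply: (gc_mp _ Hb); apply: (gc_mp _ Hi); apply: (gc_mp _ Hj).
apply: (gc_mp _ (boxplus_mono (maxn i j) Hdrop)).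
apply: (gc_mp _ (boxplus_le G (Neg (boxplus n b)) (leq_maxl i j))).
set c := Neg (boxplus n (And _ Top)).
apply: (gc_mp _ (boxplus_le G c (leq_maxr i j))); by_taut.
Qed.

(** * From the law to the modal conditions *)

Lemma inst_id ps : inst v ps [:: x0] = ps.
Proof.
have idE : seq_subst v [:: x0] =1 @Var V.
  by move=> x; rewrite /seq_subst /=; case: eqP => [<-|].
apply: map_id_in => p _.
by elim: p => //= [p ->|p -> q ->|p -> q ->|p -> q ->|p ->].
Qed.

Lemma conditions_of_WEML : has_WEML v (global_consequence L) ->
  exists n, returns n n /\
    forall m, set0 |- Or (boxplus m (Neg (boxplus n x0)))
                        (boxplus m (Neg (boxplus n (Neg (boxplus n x0))))).
Proof.
move=> [Psi IL WEML].
have IL1 G : inconsistent (global_consequence L) (G `|` [set` [:: x0]]) <->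
    (forall p, p \in Psi 1 -> G |- p).
  have [_ _ /(_ G [tuple x0]) IL1] := IL 1 isT.
  by move: IL1; rewrite inst_id.
have conj1 j G : G |- Iff (boxplus j (conj_seq [:: x0])) (boxplus j x0).
  have H1 : G |- Imp (conj_seq [:: x0]) x0 by by_taut.
  have H2 : G |- Imp x0 (conj_seq [:: x0]) by by_taut.
  apply: (gc_mp _ (boxplus_mono j H1)).
  by apply: (gc_mp _ (boxplus_mono j H2)); by_taut.
have [n Psi_n] : exists n, [set` Psi 1] |- Neg (boxplus n x0).
  have /IL1/inconsistent_seqP [n Hn] : forall p, p \in Psi 1 -> [set` Psi 1] |- p.
    by move=> p; apply: gc_hyp.
  by exists n; apply: (gc_mp _ Hn); apply: (gc_mp _ (conj1 n _)); by_taut.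
have n_Psi j p : p \in Psi 1 -> [set Neg (boxplus j x0)] |- p.
  move: p; apply/IL1/inconsistent_seqP; exists j.
  have Hj : [set Neg (boxplus j x0)] |- Neg (boxplus j x0) by exact: gc_hyp.
  by apply: (gc_mp _ Hj); apply: (gc_mp _ (conj1 j _)); by_taut.
have [k Hk] : exists k, returns n k.
  have /deduction1 [k Hk] :
      set0 `|` [set Neg (boxplus n.+1 x0)] |- Neg (boxplus n x0).
    by rewrite set0U; apply: gc_cut Psi_n; exact: n_Psi.
  exists k; apply/returnsP; apply: (gc_mp _ Hk).
  apply: (gc_mp _ (diaplus_dual set0 k (boxplus n.+1 x0))).
  by move: (boxplus n.+1 _) => P; by_taut.
pose N := maxn n k.
have HN : returns N N.
  move=> p; apply: (gc_mp _ (return_shift (leq_maxl n k) Hk p)).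
  apply: (gc_mp _ (boxplus_le set0 (Neg (boxplus N.+1 p)) (leq_maxr n k))).
  by rewrite -/N; move: (boxplus N.+1 _) => P; by_taut.
have PsiN := neg_boxplus_collapse HN Psi_n.
exists N; split=> // m.
set q1 := boxplus m _; set q2 := boxplus m _.
case Psi_size: (size (Psi 1)) => [|l].
  (* Without formulas in [Psi 1], the variable itself is inconsistent. *)
  have /(@boxplus_intro _ m) Hq1 : set0 |- Neg (boxplus N x0).
    by apply: gc_cut PsiN => q /=; rewrite (size0nil Psi_size).
  by apply: (gc_mp _ Hq1); rewrite -/q1; by_taut.
set PP := inst v (Psi (size (Psi 1))) (Psi 1).
apply: (WEML 1 isT set0 [tuple x0]); rewrite inst_id set0U.
  by apply: (gc_mp _ (boxplus_intro m PsiN)); rewrite -/q1; by_taut.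
have Psi_gt0 : 0 < size (Psi 1) by rewrite Psi_size.
have [_ _ /(_ [set` PP] (in_tuple (Psi 1))) [_ ILPP]] := IL _ Psi_gt0.
have incPP : inconsistent (global_consequence L) ([set` PP] `|` [set` Psi 1]).
  by apply: ILPP => p; exact: gc_hyp.
have /deduction1 [j Hj] : [set` PP] `|` [set Neg (boxplus N x0)] |- Bot.
  apply: gc_cut (incPP Bot) => p [PPp|/(n_Psi N) Hp].
    by apply: gc_hyp; left.
  by apply: gc_cut Hp => r ->; apply: gc_hyp; right.
have /(neg_boxplus_collapse HN) /(@boxplus_intro _ m) :
    [set` PP] |- Neg (boxplus j (Neg (boxplus N x0))).
  by apply: (gc_mp _ Hj); by_taut.
by rewrite -/q2 => Hq2; apply: (gc_mp _ Hq2); by_taut.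
Qed.

End GlobalConsequence.

Theorem theorem9p2 (V : eqType) (v : nat -> V) (v_inj : injective v)
    (L : set (form V)) (L_normal : normal_modal_logic v L) :
  has_WEML v (global_consequence L) <->
  exists n : nat,
    global_consequence L set0
      (Imp (boxplus n (Var (v 0)))
           (diaplus n (boxplus n.+1 (Var (v 0))))) /\
    forall m : nat,
      global_consequence L set0
        (Or (boxplus m (Neg (boxplus n (Var (v 0)))))
            (boxplus m (Neg (boxplus n (Neg (boxplus n (Var (v 0)))))))).
Proof.
split=> [/(conditions_of_WEML v_inj L_normal) [n [Hn Hor]]|[n [Hn Hor]]].
  by exists n; split=> //; apply/(returnsP v_inj L_normal).
apply: (WEML_of_conditions v_inj L_normal (k := n) _ Hor).
exact/(returnsP v_inj L_normal).
Qed.
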